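(* Let $d\ge 1$ and let $$f=y^{\otimes d}\oplus\bigoplus_{0\le i<d} f_i\otimes y^{\otimes i}$$ be monic, where $f_0,\dots,f_{d-1}$ are tropical polynomials in the variables $x_1,\dots,x_n$ with integer coefficients (some, but not all, of the terms $f_i$ may be absent, i.e. $f_i=\infty$). Then $$y=\bigoplus_{1\le i\le d} f_{d-i}^{\otimes(1/i)}$$ is the minimal resolution of $f$.
   Context: In the tropical semiring $\oplus$ denotes $\min$ and $\otimes$ denotes classical addition $+$; the tropical zero is $\infty$. A tropical polynomial in $x_1,\dots,x_n$ is a finite nonempty expression $\bigoplus_I a_I\otimes x^{\otimes I}$ with $I=(i_1,\dots,i_n)$ a multiindex of nonnegative integers, regarded as the function $\mathbf x\mapsto\min_I\{a_I+i_1x_1+\cdots+i_nx_n\}$ on $\mathbb{R}^n$. A tropical Newton-Puiseux polynomial is a finite nonempty expression $\bigoplus_I a_I\otimes x^{\otimes I}$ with $I\in\mathbb{Q}^n$, $a_I\in\mathbb{Q}$, regarded as a function in the same way. For a tropical polynomial $g=\bigoplus_J c_J\otimes x^{\otimes J}$ and a positive integer $i$, $g^{\otimes(1/i)}=\bigoplus_J (c_J/i)\otimes x^{\otimes(J/i)}$, i.e. classically the function $g/i$. Write $f=\bigoplus_{0\le i\le d}f_i\otimes y^{\otimes i}$ with $f_d=0$ (the classical zero function). A tropical Newton-Puiseux polynomial $y$ is a resolution of $f$ if for every $\mathbf x\in\mathbb{R}^n$ the minimum of the values $f_i(\mathbf x)+i\cdot y(\mathbf x)$, $0\le i\le d$,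 is attained for at least two different indices $i$. A resolution $y$ is minimal if $y(\mathbf x)\le z(\mathbf x)$ for every resolution $z$ and every $\mathbf x\in\mathbb{R}^n$. *)

(* Defs.v *)
From HB Require Import structures.
From mathcomp Require Import all_boot all_order all_algebra.
From mathcomp Require Import reals constructive_ereal.
Set Implicit Arguments.
Unset Strict Implicit.
Unset Printing Implicit Defensive.
Import Order.TTheory GRing.Theory Num.Theory.
Local Open Scope ring_scope.

(* A finite formal tropical sum of monomials a (x) x^I in x_1, ..., x_n, with
   rational data; the monomial is the pair (I, a).  The empty sum is the
   tropical zero, i.e. oo.  An exponent may be repeated: only the induced
   minimum function is ever used. *)
Definition texpr (n : nat) : Type := seq ('rV[rat]_n * rat).

Definition tzero (n : nat) : texpr n := [::].

(* The tropical one, i.e. the classical zero function. *)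
Definition tone (n : nat) : texpr n := [:: (0, 0)].

Definition tadd (n : nat) (p q : texpr n) : texpr n := p ++ q.

(* p^{(x)(1/i)}; only meaningful for 0 < i. *)
Definition troot (n : nat) (i : nat) (p : texpr n) : texpr n :=
  [seq (i%:R^-1 *: m.1, m.2 / i%:R) | m <- p].

(* Finite at every x unless p is tzero, in which case it is +oo. *)
Definition teval (R : realType) (n : nat) (p : texpr n) (x : 'rV[R]_n) :
    \bar R :=
  \big[Order.min/+oo%E]_(m <- p)
     (ratr m.2 + \sum_(k < n) ratr (m.1 0 k) * x 0 k)%:E.

Definition newton_puiseux (n : nat) (p : texpr n) : Prop := p <> tzero n.

Definition integral_tropical_poly (n : nat) (p : texpr n) : Prop :=
  p <> tzero n /\
  (forall m, m \in p ->
     (forall k : 'I_n, m.1 0 k \is a Num.nat) /\ m.2 \is a Num.int).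

(* f i is the coefficient of y^{(x) i}, the value tzero meaning that the term
   is absent. *)
Definition resolution (R : realType) (n d : nat)
    (f : 'I_d.+1 -> texpr n) (y : texpr n) : Prop :=
  newton_puiseux y /\
  forall x : 'rV[R]_n,
    let v (i : 'I_d.+1) := (teval (f i) x + i%:R%:E * teval y x)%E in
    exists i j : 'I_d.+1,
      [/\ i <> j, v i = v j & forall k : 'I_d.+1, (v i <= v k)%E].

Definition minimal_resolution (R : realType) (n d : nat)
    (f : 'I_d.+1 -> texpr n) (y : texpr n) : Prop :=
  resolution R f y /\
  forall z : texpr n, resolution R f z ->
    forall x : 'rV[R]_n, (teval y x <= teval z x)%E.

(* Main.v *)
Require Import Defs.
From mathcomp Require Import all_boot all_order all_algebra.
From mathcomp Require Import reals constructive_ereal.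
Set Implicit Arguments.
Unset Strict Implicit.
Unset Printing Implicit Defensive.
Import Order.TTheory GRing.Theory Num.Theory.
Local Open Scope ring_scope.

(** Fix a point x, write a_k for f_k(x), Y for the value at x of the minimum of
    the a_(d-i) / i, and let z be a real number, the tentative value of the
    unknown.  The term of index d is worth d * z because f is monic, and for
    k < d, with i = d - k,
      z <= a_k / i   <->   i * z <= a_k   <->   d * z <= a_k + k * z,
    and likewise with strict inequalities.  Taking the conjunction over k
    (lemma [lteif_teval_root_sum]): z <= Y says that the leading term is a
    minimal one, and z < Y says that it is the only minimal one.

    Both halves of the theorem are read off this equivalence. As some f_k with k
    < d is present, Y is a real number. At z = Y the leading term is minimal,
    but, as Y < Y is false, not uniquely so: hence Y resolves f. If some
    resolution took a value z < Y, then at that point the minimum would be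
    attained by the leading term alone, a contradiction. The weak and the strict
    equivalence have the same proof, so they are treated together by means of
    the relation [_ < _ ?<= if b]. *)

Definition monomial_eval (R : realType) (n : nat) (m : 'rV[rat]_n * rat)
    (x : 'rV[R]_n) : R :=
  ratr m.2 + \sum_(k < n) ratr (m.1 0 k) * x 0 k.

Lemma lteif_teval (R : realType) (n : nat) (b : bool) (c : R) (p : texpr n)
    (x : 'rV[R]_n) :
  (c%:E < teval p x ?<= if b)%O =
  all (fun m => c < monomial_eval m x ?<= if b) p.
Proof.
rewrite /teval; elim: p => [|m p IHp] /=.
  by rewrite big_nil; case: b; rewrite /= ?leey ?ltry.
by rewrite big_cons lteif_minr IHp.
Qed.

Lemma teval_fin_num (R : realType) (n : nat) (p : texpr n) (x : 'rV[R]_n) :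
  p <> tzero n -> teval p x \is a fin_num.
Proof.
rewrite /teval; elim: p => [//|m [|m' p] IHp] _; rewrite big_cons.
  by rewrite big_nil min_l // leey.
by rewrite minEle; case: ifP => // _; apply: IHp.
Qed.

Lemma monomial_eval_root (R : realType) (n i : nat) (m : 'rV[rat]_n * rat)
    (x : 'rV[R]_n) :
  monomial_eval (i%:R^-1 *: m.1, m.2 / i%:R) x = monomial_eval m x / i%:R.
Proof.
rewrite /monomial_eval /= mulrDl mulr_suml rmorphM fmorphV /= ratr_nat.
congr (_ + _); apply: eq_bigr => k _.
by rewrite mxE rmorphM fmorphV /= ratr_nat -mulrA mulrC.
Qed.

Lemma lteif_teval_root (R : realType) (n i : nat) (b : bool) (c : R)
    (p : texpr n) (x : 'rV[R]_n) :
  (0 < i)%N ->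
  (c%:E < teval (troot i p) x ?<= if b)%O =
  ((c * i%:R)%:E < teval p x ?<= if b)%O.
Proof.
move=> i_gt0; rewrite !lteif_teval all_map; apply: eq_all => m /=.
by rewrite monomial_eval_root lteif_pdivlMr ?ltr0n.
Qed.

Lemma all_tsum (I : Type) (n : nat) (P : pred ('rV[rat]_n * rat))
    (r : seq I) (F : I -> texpr n) :
  all P (\big[@tadd n/tzero n]_(i <- r) F i) = all (fun i => all P (F i)) r.
Proof.
by elim: r => [|i r IHr]; rewrite ?big_nil // big_cons /tadd all_cat IHr.
Qed.

(** The tropical sum of the i-th roots of the f (d - i), for 1 <= i <= d. *)
Definition root_sum (n d : nat) (f : 'I_d.+1 -> texpr n) : texpr n :=
  \big[@tadd n/tzero n]_(1 <= i < d.+1) troot i (f (inord (d - i))).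

(** Passing from the exponent i of the root to the index k = d - i of the
    coefficient. *)
Lemma all_root_sumP (n d : nat) (f : 'I_d.+1 -> texpr n)
    (P : pred ('rV[rat]_n * rat)) :
  reflect (forall k : 'I_d.+1, (k < d)%N -> all P (troot (d - k) (f k)))
          (all P (root_sum f)).
Proof.
rewrite /root_sum all_tsum; apply: (iffP allP) => [allP k k_lt_d|allP i].
  have /allP : (d - k)%N \in index_iota 1 d.+1.
    by rewrite mem_index_iota subn_gt0 k_lt_d ltnS leq_subr.
  by rewrite subKn ?inord_val // ltnW.
rewrite mem_index_iota ltnS => /andP[i_gt0 i_le_d].
have k_val : (inord (d - i) : 'I_d.+1) = (d - i)%N :> nat.
  by rewrite inordK // ltnS leq_subr.
have := allP (inord (d - i)).
by rewrite k_val subKn // ltn_subrL i_gt0 (leq_trans i_gt0) //; apply.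
Qed.

Lemma root_sum_neq0 (n d : nat) (f : 'I_d.+1 -> texpr n) :
  (exists2 k : 'I_d.+1, (k < d)%N & f k <> tzero n) ->
  root_sum f <> tzero n.
Proof.
move=> [k k_lt_d fk_neq0] sum_eq0.
(* An expression is empty iff all its monomials satisfy the empty predicate. *)
have /all_root_sumP/(_ k k_lt_d) : all pred0 (root_sum f) by rewrite sum_eq0.
by case: (f k) fk_neq0.
Qed.

(** With b true (resp. false), the right-hand side says that the leading term
    d * z of a monic f is minimal (resp. strictly smaller than all the others)
    when the unknown takes the value z. *)
Lemma lteif_teval_root_sum (R : realType) (n d : nat) (f : 'I_d.+1 -> texpr n)
    (b : bool) (z : R) (x : 'rV[R]_n) :
  (z%:E < teval (root_sum f) x ?<= if b)%O <->
  (forall k : 'I_d.+1, (k < d)%N ->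
     ((d%:R%:E * z%:E)%E < (teval (f k) x + k%:R%:E * z%:E)%E ?<= if b)%O).
Proof.
have termE (k : 'I_d.+1) : (k < d)%N ->
  (z%:E < teval (troot (d - k) (f k)) x ?<= if b)%O =
  ((d%:R%:E * z%:E)%E < (teval (f k) x + k%:R%:E * z%:E)%E ?<= if b)%O.
  move=> k_lt_d; rewrite lteif_teval_root ?subn_gt0 // natrB ?(ltnW k_lt_d) //.
  rewrite -!EFinM mulrBr ![z * _]mulrC EFinB.
  by case: b; [apply: leeBlDr | apply: lteBlDr].
rewrite lteif_teval; split=> [/all_root_sumP le_z k k_lt_d|le_z].
  by rewrite -termE // lteif_teval le_z.
by apply/all_root_sumP => k k_lt_d; rewrite -lteif_teval termE // le_z.
Qed.

Theorem proposition1p7 (R : realType) (n d : nat) (hd : (1 <= d)%N)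
    (f : 'I_d.+1 -> texpr n)
    (hmonic : f ord_max = tone n)
    (hpoly : forall i : 'I_d.+1, (i < d)%N ->
       f i = tzero n \/ integral_tropical_poly (f i))
    (hpresent : exists2 i : 'I_d.+1, (i < d)%N & f i <> tzero n) :
  minimal_resolution R f
    (\big[@tadd n/tzero n]_(1 <= i < d.+1) troot i (f (inord (d - i)))).
Proof.
rewrite -/(root_sum f).
have ltn_d (k : 'I_d.+1) : k <> ord_max -> (k < d)%N.
  move=> k_neq; rewrite ltn_neqAle -ltnS ltn_ord andbT; apply/eqP => k_eq.
  by apply: k_neq; apply: val_inj.
have eval_lead (x : 'rV[R]_n) : teval (f ord_max) x = 0%E.
  rewrite hmonic /teval /tone big_seq1 /= rmorph0 add0r big1 // => k _.
  by rewrite mxE rmorph0 mul0r.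
have sum_neq0 := root_sum_neq0 hpresent.
split=> [|z [z_neq0 z_res] x].
  split=> // x v; have y_fin := teval_fin_num x sum_neq0.
  set z := fine (teval (root_sum f) x).
  have zE : teval (root_sum f) x = z%:E by rewrite fineK.
  have v_lead : v ord_max = (d%:R%:E * z%:E)%E.
    by rewrite /v eval_lead add0e zE.
  have lead_le (k : 'I_d.+1) : (v ord_max <= v k)%E.
    have [->//|/eqP/ltn_d k_lt_d] := eqVneq k ord_max.
    have /(lteif_teval_root_sum f true z x)/(_ k k_lt_d) :
      (z%:E <= teval (root_sum f) x)%E by rewrite zE.
    by rewrite v_lead /v zE.
  have /existsP[k /andP[k_lt_d v_le]] :
    [exists k : 'I_d.+1, (k < d)%N && (v k <= v ord_max)%E].
    (* Otherwise the leading term is strictly minimal, so that Y < Y. *)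
    apply: contraT; rewrite negb_exists => /forallP v_gt.
    suff /(lteif_teval_root_sum f false z x) :
      forall k : 'I_d.+1, (k < d)%N ->
        (d%:R%:E * z%:E < teval (f k) x + k%:R%:E * z%:E)%E.
      by rewrite zE /= ltxx.
    move=> k k_lt_d; have := v_gt k.
    by rewrite k_lt_d /= -ltNge v_lead /v zE.
  exists ord_max, k; split=> //.
    by move=> k_max; rewrite -k_max ltnn in k_lt_d.
  by apply/le_anti; rewrite lead_le v_le.
rewrite leNgt; apply/negP; have zE := fineK (teval_fin_num x z_neq0).
rewrite -zE => /(lteif_teval_root_sum f false _ x) lead_lt.
have [i [j [i_neq_j v_eq v_min]]] := z_res x.
(* One of the two minimal indices is not the leading one. *)
have [k k_lt_d v_le] : exists2 k : 'I_d.+1, (k < d)%N &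
    (teval (f k) x + k%:R%:E * teval z x <=
     teval (f ord_max) x + d%:R%:E * teval z x)%E.
  have [i_max|/eqP/ltn_d i_lt_d] := eqVneq i ord_max; last first.
    by exists i => //; apply: v_min ord_max.
  exists j; last by rewrite -v_eq; apply: v_min ord_max.
  by apply: ltn_d => j_max; apply: i_neq_j; rewrite i_max.
have := lead_lt k k_lt_d.
by rewrite zE /= ltNge -[X in (_ <= X)%E]add0e -(eval_lead x) v_le.
Qed.
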